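(* Let $X$ be a Čech-complete topological group and $Y$ be any topological group. Every universally BP-measurable homomorphism $h:X\to Y$ is continuous.
   Context: A Tychonoff space is Čech-complete if it is homeomorphic to a $G_\delta$-subset of some compact Hausdorff space. A subset of a space has the Baire Property if it belongs to the smallest $\sigma$-algebra containing all open and all meager subsets of the space. A function $f:X\to Y$ between topological spaces is universally BP-measurable if for every open $U\subseteq Y$ and every closed $F\subseteq X$ the set $F\cap f^{-1}[U]$ has the Baire Property in the subspace $F$. *)

(* Defs.v *)
From HB Require Import structures.
From mathcomp Require Import all_boot all_order all_algebra.
From mathcomp Require Import all_classical all_reals topology measure borel_hierarchy.
From mathcomp Require Import Rstruct Rstruct_topology.
From Stdlib Require Rdefinitions.

Set Implicit Arguments.
Unset Strict Implicit.
Unset Printing Implicit Defensive.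

Local Open Scope classical_set_scope.

Record topGroup (G : topologicalType) := TopGroup {
  gmul : G -> G -> G;
  ginv : G -> G;
  gone : G;
  gmulA : forall x y z, gmul x (gmul y z) = gmul (gmul x y) z;
  gmul1 : forall x, gmul gone x = x;
  gmulV : forall x, gmul (ginv x) x = gone;
  gmul_cont : continuous (fun p : G * G => gmul p.1 p.2);
  ginv_cont : continuous ginv
}.

Definition group_hom (X Y : topologicalType) (gX : topGroup X) (gY : topGroup Y)
  (h : X -> Y) : Prop :=
  forall x y, h (gmul gX x y) = gmul gY (h x) (h y).

Definition tychonoff_space (X : topologicalType) : Prop :=
  accessible_space X /\
  forall (A : set X) (x : X), closed A -> ~ A x ->
    exists f : X -> Rdefinitions.R, continuous f /\ f x = 0%R /\ (forall a, A a -> f a = 1%R).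

Definition homeomorphic (X Y : topologicalType) : Prop :=
  exists (f : X -> Y) (g : Y -> X),
    cancel f g /\ cancel g f /\ continuous f /\ continuous g.

(* Cech-complete: Tychonoff and homeomorphic to a G_delta subset (with the
   subspace topology, realized on the sigma type set_type G) of a compact
   Hausdorff space. *)
Definition cech_complete (X : topologicalType) : Prop :=
  tychonoff_space X /\
  exists K : topologicalType,
    compact [set: K] /\ hausdorff_space K /\
    exists G : set K, Gdelta G /\ homeomorphic X (set_type G).

Definition nowhere_dense (T : topologicalType) (A : set T) : Prop :=
  interior (closure A) = set0.

Definition meager (T : topologicalType) (A : set T) : Prop :=
  exists N : nat -> set T,
    (forall n, nowhere_dense (N n)) /\ A `<=` \bigcup_n N n.

Definition baire_property (T : topologicalType) (A : set T) : Prop :=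
  <<s [set B : set T | open B \/ meager B] >> A.

Definition universally_BP_measurable (X Y : topologicalType) (f : X -> Y) : Prop :=
  forall (U : set Y) (F : set X), open U -> closed F ->
    baire_property [set x : set_type F | U (f (set_val x))].

(* Main.v *)
(* Let [U] be an open neighbourhood of [1] in [Y].  If [h @^-1` U] is nonmeager,
   Pettis' argument makes its quotient set a neighbourhood of [1] in [X].
   Otherwise it lies in a union of nowhere dense sets [N k], and Mycielski's
   construction yields a Cantor scheme in [X] in which points [x], [y] of distinct
   branches never satisfy [x^-1 y \in N k].  Hence, for every set [S] of branches,
   some open set of [Y] has an [h]-preimage that contains the branches in [S] and
   misses the others.  Inside a closed set that is minimal among those meeting all
   cells, the cells form a pi-base, and taking for [S] a nonprincipal ultrafilter
   on [nat] contradicts the Baire property there.  No weight restriction on [X] or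
   [Y] is needed because everything happens over the Cantor set. *)
Require Import Defs.
From HB Require Import structures.
From mathcomp Require Import all_boot all_order all_algebra.
From mathcomp Require Import all_classical all_reals topology measure borel_hierarchy.

Set Implicit Arguments.
Unset Strict Implicit.
Unset Printing Implicit Defensive.

Local Open Scope classical_set_scope.

(** * Dependent choice, compactness and minimal closed sets *)

Lemma dep_choice (T : Type) (P : nat -> T -> Prop) (R : nat -> T -> T -> Prop) x0 :
  P 0 x0 -> (forall n x, P n x -> exists2 y, P n.+1 y & R n x y) ->
  exists f, [/\ f 0 = x0, forall n, P n (f n) & forall n, R n (f n) (f n.+1)].
Proof.
move=> P0 step.
have /choice[g gP] : forall nx : nat * T, exists y,
    P nx.1 nx.2 -> P nx.1.+1 y /\ R nx.1 nx.2 y.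
  move=> [n x] /=; have [Px|nPx] := pselect (P n x); last by exists x.
  by have [y Py Rxy] := step _ _ Px; exists y.
pose f := fix f n := if n is m.+1 then g (m, f m) else x0.
have Pf n : P n (f n) by elim: n => [//|n IH]; exact: (gP (n, f n) IH).1.
by exists f; split => // n; exact: (gP (n, f n) (Pf n)).2.
Qed.

Lemma compact_directed_bigcap (K : topologicalType) (I : Type) (D : set I)
    (C : I -> set K) :
  compact [set: K] -> D !=set0 ->
  (forall i j, D i -> D j -> exists2 k, D k & C k `<=` C i `&` C j) ->
  (forall i, D i -> closed (C i)) -> (forall i, D i -> C i !=set0) ->
  \bigcap_(i in D) C i !=set0.
Proof.
move=> cK [i0 Di0] Cdir Cclosed C0.
have FF : ProperFilter (filter_from D C).
  apply: filter_from_proper => //; apply: filter_from_filter => //.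
  by exists i0.
have [x [_ xC]] := cK _ FF filterT.
exists x => i Di; apply: Cclosed => // B xB.
by apply: xC => //; exists i.
Qed.

(** Zorn's lemma is applied to the open complements: compactness keeps the union of a chain in the
    family. If [O] meets the complement [F] of a maximal [A], then [A] enlarged by [O] leaves the
    family, which puts some trace [D i] on [F] inside [O]. So the traces behave like a pi-base of
    [F]. *)
Lemma minimal_closed_transversal (K : topologicalType) (I : Type) (D : I -> set K) :
  compact [set: K] -> (forall i, closed (D i)) -> (forall i, D i !=set0) ->
  exists F, [/\ closed F, forall i, (D i `&` F) !=set0 &
    forall O, open O -> (O `&` F) !=set0 -> exists i, D i `&` F `<=` O].
Proof.
move=> cK Dcl D0.
pose P (O : set K) := open O /\ forall i, (D i `&` ~` O) !=set0.
have chain (C : set (set K)) : C `<=` P -> total_on C subset ->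
    P (\bigcup_(X in C) X).
  move=> CP tot; split; first by apply: bigcup_open => X /CP[].
  move=> i; have [C0|C0] := pselect (C !=set0); last first.
    have [x Dx] := D0 i; exists x; split=> // -[X CX _].
    by apply: C0; exists X.
  have /(_ cK C0)[] := @compact_directed_bigcap K _ C (fun X => D i `&` ~` X).
  - move=> X Y CX CY; have [XY|YX] := tot _ _ CX CY.
      by exists Y => // x [Dx nYx]; split; split=> // /XY.
    by exists X => // x [Dx nXx]; split; split=> // /YX.
  - move=> X /CP[oX _]; apply: closedI => //; exact: open_closedC.
  - by move=> X /CP[_]; exact.
  - move=> x xC; exists x; split.
      by have [X CX] := C0; case: (xC X CX).
    by move=> [X CX Xx]; case: (xC X CX).
have [A [[oA DA] maxA]] := Zorn_bigcup chain.
exists (~` A); split => [|//|O oO [x [Ox nAx]]].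
  exact: open_closedC.
apply: contrapT => nD; apply: (maxA (A `|` O)).
  by split; [left|move=> /(_ x (or_intror Ox))].
split; first exact: openU.
move=> i; apply: contrapT => Di0; apply: nD; exists i => y [Dy nAy].
by apply: contrapT => nOy; apply: Di0; exists y; split=> // -[].
Qed.

(** * Meager sets and the Baire property *)

Lemma nowhere_dense_avoid (T : topologicalType) (N W : set T) :
  nowhere_dense N -> open W -> W !=set0 -> (W `\` closure N) !=set0.
Proof.
move=> ndN oW [x Wx]; apply: contrapT => W0.
suff: interior (closure N) x by rewrite ndN.
suff /(_ x Wx) : W `<=` interior (closure N) by [].
rewrite -open_subsetE // => y Wy; apply: contrapT => nNy; apply: W0.
by exists y.
Qed.

Lemma nowhere_denseP (T : topologicalType) (N : set T) :
  (forall W, open W -> W !=set0 -> (W `\` closure N) !=set0) -> nowhere_dense N.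
Proof.
move=> avN; apply/seteqP; split => // x Nx.
have [||y [Ny]] := avN (interior (closure N)); first exact: open_interior.
  by exists x.
by case; exact: interior_subset.
Qed.

Lemma nowhere_dense0 (T : topologicalType) : nowhere_dense (@set0 T).
Proof. by rewrite /nowhere_dense closure0 interior0. Qed.

Lemma meagerS (T : topologicalType) (A B : set T) :
  A `<=` B -> meager B -> meager A.
Proof.
by move=> AB [N [ndN BN]]; exists N; split=> //; exact: subset_trans BN.
Qed.

Lemma nowhere_dense_meager (T : topologicalType) (A : set T) :
  nowhere_dense A -> meager A.
Proof. by move=> ndA; exists (fun=> A); split=> // x Ax; exists 0. Qed.

Lemma meager_bigcup (T : topologicalType) (A : nat -> set T) :
  (forall n, meager (A n)) -> meager (\bigcup_n A n).
Proof.
move=> /choice[N NP].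
(* The double family is listed through a coding of pairs; numbers that code no pair receive the
   empty set. *)
exists (fun n => if @unpickle (nat * nat)%type n is Some ij
                 then N ij.1 ij.2 else set0); split.
  move=> n; case: unpickle => [ij|]; last exact: nowhere_dense0.
  by apply: (NP _).1.
move=> x [i _ /(NP i).2[j _ Nx]].
by exists (pickle (i, j)) => //; rewrite pickleK.
Qed.

Lemma meagerU (T : topologicalType) (A B : set T) :
  meager A -> meager B -> meager (A `|` B).
Proof.
move=> mA mB.
apply: (@meagerS _ _ (\bigcup_n if n is 0 then A else B)); last first.
  by apply: meager_bigcup => -[].
by move=> x [Ax|Bx]; [exists 0|exists 1%N].
Qed.

Lemma nowhere_dense_boundary (T : topologicalType) (O : set T) :
  open O -> nowhere_dense (closure O `\` O).
Proof.
move=> oO; apply: nowhere_denseP => W oW [x Wx].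
have -> : closure (closure O `\` O) = closure O `\` O.
  symmetry; apply/closure_id; apply: closedI; first exact: closed_closure.
  exact: open_closedC.
have [[y [Oy Wy]]|] := pselect ((O `&` W) !=set0).
  by exists y; split=> // -[].
move=> OW; exists x; split=> // -[/(_ W) Ox _]; apply: OW; apply: Ox.
exact: open_nbhs_nbhs.
Qed.

(** The sets that equal an open set modulo meager sets form a sigma-algebra containing the
    generators. *)
Lemma baire_property_open (T : topologicalType) (A : set T) :
  baire_property A ->
  exists O, [/\ open O, meager (O `\` A) & meager (A `\` O)].
Proof.
have meager0 : meager (@set0 T) by exact/nowhere_dense_meager/nowhere_dense0.
move: A; apply: smallest_sub; first split.
- by exists set0; split; [exact: open0| |]; rewrite setDv.
(* The complement of [A] is approximated by the exterior of [O]; the extra error is the boundary of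
   [O], which is nowhere dense. *)
- move=> A [O [oO OA AO]]; exists (~` closure O); split.
  + exact/closed_openC/closed_closure.
  + apply: (meagerS _ AO) => x [nOx nAx].
    split; first by apply: contrapT => nAx'; apply: nAx.
    by move=> /subset_closure.
  + apply: (meagerS _ (meagerU OA (nowhere_dense_meager (nowhere_dense_boundary oO)))).
    move=> x [[_ nAx] /contrapT Ox].
    by have [Ox'|nOx] := pselect (O x); [left|right].
- move=> A /choice[O OP]; exists (\bigcup_n O n); split.
  + by apply: bigcup_open => i _; have [] := OP i.
  + apply: (@meagerS _ _ (\bigcup_n (O n `\` A n))); last first.
      by apply: meager_bigcup => n; have [] := OP n.
    by move=> x [[i _ Ox] nAx]; exists i => //; split=> // Ax; apply: nAx; exists i.
  + apply: (@meagerS _ _ (\bigcup_n (A n `\` O n))); last first.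
      by apply: meager_bigcup => n; have [] := OP n.
    by move=> x [[i _ Ox] nAx]; exists i => //; split=> // Ax; apply: nAx; exists i.
- move=> A [oA|mA]; first by exists A; split => //; rewrite setDv.
  by exists set0; split; [exact: open0|rewrite set0D|rewrite setD0].
Qed.

(** * Čech-complete spaces seen inside a compact Hausdorff space *)

(** The embedding onto a G_delta set is kept as a map [e] whose range is the intersection of the
    [G n] and which pulls back the topology of [K]. Nested constructions can then take place among
    open sets of [K]. *)
Record cech_chart (X K : topologicalType) (e : X -> K) (G : nat -> set K) : Prop :=
  CechChart {
    chart_compact : compact [set: K];
    chart_hausdorff : hausdorff_space K;
    chart_open : forall n, open (G n);
    chart_cont : continuous e;
    chart_initial : forall O, open O -> exists2 O', open O' & e @^-1` O' = O;
    chart_mem : forall x n, G n (e x);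
    chart_range : forall y, (forall n, G n y) -> exists x, e x = y }.

Lemma cech_complete_chart (X : topologicalType) :
  cech_complete X -> exists (K : topologicalType) (e : X -> K) G, cech_chart e G.
Proof.
move=> [_ [K [cK [hK [_ [[G oG ->] [f [g [fK [gK [cf cg]]]]]]]]]]].
have valc : continuous (set_val : set_type (\bigcap_n G n) -> K).
  exact: initial_continuous.
exists K, (fun x => set_val (f x)), G; split=> //.
- by move=> x; apply: continuous_comp; [exact: cf|exact: valc].
- move=> O oO; have : open (g @^-1` O) by apply: open_comp => // x _; exact: cg.
  move=> [O' oO' eO]; exists O' => //; apply/seteqP.
  have eO' x : O' (set_val (f x)) = O x.
    by rewrite -[in RHS](fK x) -[RHS]/((g @^-1` O) (f x)) -eO.
  by split=> x /=; rewrite eO'.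
- by move=> x n; have := set_valP (f x); exact.
- move=> y Gy; have Gy' : y \in \bigcap_n G n by apply/mem_set => n _; exact: Gy.
  by exists (g (SigSub Gy')); rewrite gK.
Qed.

Lemma chart_shrink (X K : topologicalType) (e : X -> K) G (O : set K) x n :
  cech_chart e G -> open O -> O (e x) ->
  exists O', [/\ open O', O' (e x) & closure O' `<=` O `&` G n].
Proof.
move=> ch oO Ox.
have [|V xV VO] := @compact_regular K (e x) setT (chart_hausdorff ch)
    (chart_compact ch) filterT (O `&` G n).
  apply: open_nbhs_nbhs; split; last by split=> //; exact: chart_mem ch _ _.
  by apply: openI => //; exact: chart_open ch n.
exists (interior V); split=> //; first exact: open_interior.
exact: subset_trans (closure_subset (@interior_subset _ V)) VO.
Qed.

(** Compactness gives a common point in [K]; it lies in every [G n] because [D n.+1] does, hence it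
    comes from [X]. *)
Lemma chart_nested (X K : topologicalType) (e : X -> K) G (D : nat -> set K) :
  cech_chart e G -> (forall n, closed (D n)) -> (forall n, D n !=set0) ->
  (forall n, D n.+1 `<=` D n `&` G n) -> exists x, forall n, D n (e x).
Proof.
move=> ch cD D0 DS.
have Dle n m : D (n + m)%N `<=` D n.
  by elim: m => [|m IH]; rewrite ?addn0 ?addnS // => y /DS[/IH].
have [] := @compact_directed_bigcap K nat setT D (chart_compact ch) => //.
- move=> i j _ _; exists (i + j)%N => // y Dy.
  by split; [apply: Dle Dy|move: Dy; rewrite addnC; exact: Dle].
move=> y Dy.
have [|x xy] := chart_range ch (y := y); first by move=> n; have [] := DS n y (Dy _ I).
by exists x => n; rewrite xy; exact: Dy.
Qed.

(** Baire category: open sets of [K] are shrunk so that stage [n] avoids [N n], and [chart_nested]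
    gives a point of [O] outside all of them. *)
Lemma chart_baire (X K : topologicalType) (e : X -> K) G (O : set X) :
  cech_chart e G -> open O -> O !=set0 -> ~ meager O.
Proof.
move=> ch oO O0 [N [ndN ON]].
have [O' oO' eO] := chart_initial ch oO.
pose P (n : nat) (V : set K) := open V /\ exists x, V (e x).
pose R (n : nat) (V V' : set K) :=
  closure V' `<=` V `&` G n /\ forall x, closure V' (e x) -> ~ N n x.
have [||V [V0 VP VR]] := @dep_choice _ P R O'.
- by split=> //; have [x Ox] := O0; exists x; move: Ox; rewrite -eO.
- move=> n V [oV [x Vx]].
  have [||y [Vy nNy]] := @nowhere_dense_avoid _ (N n) (e @^-1` V) (ndN n).
  + by apply: open_comp => // z _; exact: chart_cont ch _.
  + by exists x.
  have [W oW eW] := chart_initial ch (closed_openC (@closed_closure _ (N n))).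
  have Wy : W (e y) by rewrite -[W _]/((e @^-1` W) y) eW.
  have [|V' [oV' V'y V'V]] := chart_shrink n ch (openI oV oW) (x := y) => //.
  exists V'; first by split=> //; exists y.
  split; first by move=> z /V'V[[]].
  move=> z /V'V[[_ Wz] _].
  have : (e @^-1` W) z by [].
  by rewrite eW => nNz /subset_closure.
have VS n : closure (V n.+1) `<=` V n `&` G n by have [] := VR n.
have [|||x Dx] := @chart_nested _ _ e G (fun n => closure (V n)) ch.
- by move=> n; exact: closed_closure.
- by move=> n; have [_ [x Vx]] := VP n; exists (e x); exact: subset_closure.
- by move=> n y /VS[Vy Gy]; split=> //; exact: subset_closure.
(* Only closures are known to contain the point, so membership in [V 0] is read off one stage
   later. *)
have : O x by rewrite -eO /= -V0; have [] := VS 0 _ (Dx 1%N).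
by move=> /ON[n _]; apply: (VR n).2; exact: Dx.
Qed.

(** * Cantor schemes whose cells form a pi-base *)

Definition branch (T : Type) (D : seq bool -> set T) (q : nat -> bool) : set T :=
  \bigcap_n D (mkseq q n).

(** The word [g i.+1] has more than [i] letters, so its letter [i] is final and the default [false]
    is never read. *)
Lemma mkseq_limit (g : nat -> seq bool) :
  (forall n, exists u, g n.+1 = g n ++ u) -> (forall n, n <= size (g n)) ->
  forall n, mkseq (fun i => nth false (g i.+1) i) (size (g n)) = g n.
Proof.
move=> gS gsize n.
have gadd m k : exists u, g (m + k)%N = g m ++ u.
  elim: k => [|k [u IH]]; first by exists [::]; rewrite addn0 cats0.
  by have [v gv] := gS (m + k)%N; exists (u ++ v); rewrite addnS gv IH catA.
have nthg m k i : i < size (g m) -> nth false (g (m + k)%N) i = nth false (g m) i.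
  by have [u ->] := gadd m k; rewrite nth_cat => ->.
apply: (@eq_from_nth _ false); rewrite size_mkseq // => i lti.
rewrite nth_mkseq // -(nthg i.+1 n) ?gsize //.
by rewrite addnC nthg.
Qed.

Section Branches.
Context {T : topologicalType} {D : seq bool -> set T}.
Hypothesis D0 : forall s, D s !=set0.
Hypothesis DS : forall s b, D (rcons s b) `<=` D s.
Hypothesis Ddisj : forall s t, size s = size t -> (D s `&` D t) !=set0 -> s = t.
Hypothesis Dbase : forall O, open O -> O !=set0 -> exists s, D s `<=` O.
Hypothesis Dfat : forall s, exists O, [/\ open O, O !=set0 & O `<=` D s].

Let Dcat s t : D (s ++ t) `<=` D s.
Proof.
elim/last_ind: t => [|t b IH]; first by rewrite cats0.
by rewrite -rcons_cat; exact: subset_trans (@DS _ _) IH.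
Qed.

Let branchS q n : branch D q `<=` D (mkseq q n).
Proof. by move=> x; apply. Qed.

(** Some cell [D t] lies in an open part of [D s] off the closure of [N]. As [D s] and [D t] meet,
    one word is a prefix of the other: either [t] extends [s], or [D s] is already inside [D t]. *)
Lemma scheme_avoid (N : set T) s :
  nowhere_dense N -> exists u, D (s ++ u) `&` N = set0.
Proof.
move=> ndN; have [O [oO O0 OD]] := Dfat s.
have [||t tO] := @Dbase (O `\` closure N).
- by apply: openI => //; exact/closed_openC/closed_closure.
- exact: nowhere_dense_avoid.
have tN : D t `&` N = set0.
  apply/seteqP; split=> // x [/tO[_ nNx] Nx]; apply: nNx.
  exact: subset_closure.
have [x Dtx] := D0 t; have Dsx : D s x by apply: OD; case: (tO x Dtx).
have take_sub m r : D r `<=` D (take m r).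
  by rewrite -{1}(cat_take_drop m r); exact: Dcat.
have [le_st|/ltnW le_ts] := leqP (size s) (size t).
  exists (drop (size s) t).
  suff {1}-> : s = take (size s) t by rewrite cat_take_drop.
  apply: Ddisj; first by rewrite size_takel.
  by exists x; split=> //; exact: take_sub.
exists [::]; rewrite cats0.
have ts : t = take (size t) s.
  apply: Ddisj; first by rewrite size_takel.
  by exists x; split=> //; exact: take_sub.
apply/seteqP; split=> // y [Dsy Ny].
suff : (D t `&` N) y by rewrite tN.
by split=> //; rewrite ts; exact: take_sub.
Qed.

(** Two words are grown beyond [s], each the letterwise negation of the other, and step [n] extends
    both until their cells miss [N n]. *)
Lemma complementary_branches (N : nat -> set T) s :
  (forall n, nowhere_dense (N n)) ->
  exists q q', [/\ mkseq q (size s) = s, mkseq q' (size s) = s,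
    forall n, size s <= n -> q' n = ~~ q n &
    forall n, branch D q `&` N n = set0 /\ branch D q' `&` N n = set0].
Proof.
move=> ndN.
pose R n w v := exists u : seq bool, [/\ v = w ++ u, 0 < size u,
  D (s ++ v) `&` N n = set0 & D (s ++ map negb v) `&` N n = set0].
have avoidW w u n : D w `&` N n = set0 -> D (w ++ u) `&` N n = set0.
  by move=> wN; apply/seteqP; split=> // y [/Dcat Dy Ny]; rewrite -wN.
have [//|n w _|f [f0 _ fR]] := @dep_choice _ (fun _ _ => True) R [::].
  have [u uN] := scheme_avoid (s ++ w) (ndN n).
  have [v vN] := scheme_avoid (s ++ map negb (w ++ u)) (ndN n).
  (* The extension [v] serves the negated word, so it enters negated here; the last letter forces
     strict growth. *)
  exists (w ++ (u ++ map negb v ++ [:: true])) => //.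
  exists (u ++ map negb v ++ [:: true]); split=> //.
  - by rewrite !size_cat !addnS.
  - by rewrite 2!catA; exact: avoidW.
  - rewrite [w ++ _]catA map_cat [map _ (_ ++ [:: true])]map_cat (mapK negbK) 2!catA.
    exact: avoidW.
have fsize n : n <= size (f n).
  elim: n => // n IH; have [u [-> u0 _ _]] := fR n.
  by rewrite size_cat -addn1 leq_add.
have nth_lim (g : nat -> seq bool) (gg := fun n => s ++ g n) :
    (forall n, exists u, g n.+1 = g n ++ u) -> (forall n, n <= size (g n)) ->
    forall n, mkseq (fun i => nth false (gg i.+1) i) (size (gg n)) = gg n.
  move=> gS gsize n; apply: (@mkseq_limit gg) => m.
    by have [u gu] := gS m; exists u; rewrite /gg gu catA.
  by rewrite /gg size_cat (leq_trans (gsize m)) // leq_addl.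
have fS n : exists u, f n.+1 = f n ++ u by have [u [? _ _ _]] := fR n; exists u.
have lim1 := nth_lim f fS fsize.
have lim2 : forall n, mkseq (fun i => nth false (s ++ map negb (f i.+1)) i)
    (size (s ++ map negb (f n))) = s ++ map negb (f n).
  apply: (nth_lim (fun n => map negb (f n))) => n; last by rewrite size_map.
  by have [u ->] := fS n; exists (map negb u); rewrite map_cat.
exists (fun i => nth false (s ++ f i.+1) i).
exists (fun i => nth false (s ++ map negb (f i.+1)) i); split.
- by have := lim1 0; rewrite f0 cats0.
- by have := lim2 0; rewrite f0 cats0.
- move=> n sn; rewrite !nth_cat ltnNge sn /= (nth_map false) //.
  by rewrite (leq_trans _ (fsize n.+1)) // ltnS leq_subr.
- move=> n; have [u [_ _ N1 N2]] := fR n; split; apply/seteqP; split=> // x [qx Nx].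
    by rewrite -N1; split=> //; rewrite -lim1; exact: branchS qx.
  by rewrite -N2; split=> //; rewrite -lim2; exact: branchS qx.
Qed.

End Branches.

(* For [S] a nonprincipal ultrafilter on [nat], two branches that are complementary
   up to finitely many coordinates are never both in [S] nor both outside [S]. *)
Lemma no_baire_selector : exists S : set (nat -> bool),
  forall (T : topologicalType) (D : seq bool -> set T) (W : set T),
  (forall s b, D (rcons s b) `<=` D s) ->
  (forall s t, size s = size t -> (D s `&` D t) !=set0 -> s = t) ->
  (forall O, open O -> O !=set0 -> exists s, D s `<=` O) ->
  (forall s, exists O, [/\ open O, O !=set0 & O `<=` D s]) ->
  (forall q, branch D q !=set0) ->
  baire_property W ->
  (forall q, S q -> branch D q `<=` W) ->
  (forall q, ~ S q -> branch D q `&` W = set0) -> False.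
Proof.
have [U [UU ooU]] := @ultraFilterLemma nat \oo _.
pose S (q : nat -> bool) := U [set n | q n].
exists S => T D W DS Ddisj Dbase Dfat branch0 bpW SW nSW.
have compl k q q' : (forall n, k <= n -> q' n = ~~ q n) -> S q -> S q' -> False.
  move=> qq' Sq Sq'; apply: (@filter_not_empty _ U _).
  have Uk : U [set n | k <= n] by apply: ooU; exact: nbhs_infty_ge.
  apply: filterS (filterI Uk (filterI Sq Sq')) => n /= [kn [qn]].
  by rewrite qq' // qn.
have D0 s : D s !=set0.
  by have [O [_ [x Ox] OD]] := Dfat s; exists x; exact: OD.
have nS q : ~ S q -> S (negb \o q).
  move=> nSq; have [//|] := in_ultra_setVsetC [set n | q n] UU.
  by apply: filterS => n /= /negP.
have [O [oO [N1 [ndN1 ON1]] [N2 [ndN2 ON2]]]] := baire_property_open bpW.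
have [O0|O0] := pselect (O !=set0).
(* Here [W] is comeager in a cell: two complementary branches in it avoid the exceptional set, so
   they meet [W] and both belong to [S]. *)
- have [s sO] := Dbase O oO O0.
  have [q [q' [qs q's qq' qN]]] :=
    complementary_branches D0 DS Ddisj Dbase Dfat s ndN1.
  have inS p : mkseq p (size s) = s -> (forall n, branch D p `&` N1 n = set0) -> S p.
    move=> ps pN; apply: contrapT => /nSW pW.
    have [x px] := branch0 p.
    have Ox : O x by apply: sO; rewrite -ps; exact: px.
    have [|n _ Nx] := ON1 x.
      by split=> // Wx; suff : (branch D p `&` W) x by rewrite pW.
    by suff : (branch D p `&` N1 n) x by rewrite pN.
  by apply: (compl _ _ _ qq'); apply: inS => // n; have [] := qN n.
- have [q [q' [_ _ qq' qN]]] :=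
    complementary_branches D0 DS Ddisj Dbase Dfat [::] ndN2.
  have ninS p : (forall n, branch D p `&` N2 n = set0) -> ~ S p.
    move=> pN Sp; have [x px] := branch0 p.
    have [|n _ Nx] := ON2 x.
      by split; [exact: SW px|move=> Ox; apply: O0; exists x].
    by suff : (branch D p `&` N2 n) x by rewrite pN.
  (* Here [W] is meager and two complementary branches are outside [S]; their negations are in [S]
     and again complementary. *)
  apply: (compl 0 (negb \o q) (negb \o q')).
  + by move=> n _ /=; rewrite qq'.
  + by apply/nS/ninS => n; have [] := qN n.
  + by apply/nS/ninS => n; have [] := qN n.
Qed.

(** * Topological groups and Pettis' argument *)

Lemma nowhere_dense_preimage (T T' : topologicalType) (f : T -> T') (g : T' -> T)
    (N : set T') :
  cancel f g -> cancel g f -> continuous f -> continuous g ->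
  nowhere_dense N -> nowhere_dense (f @^-1` N).
Proof.
move=> fK gK cf cg ndN; apply: nowhere_denseP => W oW [x Wx].
have [||y [Wy nNy]] := @nowhere_dense_avoid _ N (g @^-1` W) ndN.
- by apply: open_comp => // ? _; exact: cg.
- by exists (f x); rewrite /= fK.
exists (g y); split=> // cNy; apply: nNy => B yB.
have /cNy[z [Nz Bz]] : nbhs (g y) (f @^-1` B) by apply: cf; rewrite gK.
by exists (f z).
Qed.

(** Only the left laws are axioms; this one follows by inserting the inverse of [ginv gX x] times
    [ginv gX x] in front. *)
Lemma gmulrV (X : topologicalType) (gX : topGroup X) x :
  gmul gX x (ginv gX x) = gone gX.
Proof.
rewrite -[LHS](gmul1 gX) -{1}(gmulV gX (ginv gX x)) -gmulA.
by rewrite (gmulA gX (ginv gX x)) gmulV gmul1 gmulV.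
Qed.

Lemma gmulr1 (X : topologicalType) (gX : topGroup X) x : gmul gX x (gone gX) = x.
Proof. by rewrite -(gmulV gX x) gmulA gmulrV gmul1. Qed.

Lemma gmulK (X : topologicalType) (gX : topGroup X) x y :
  gmul gX (ginv gX x) (gmul gX x y) = y.
Proof. by rewrite gmulA gmulV gmul1. Qed.

Lemma gmulVK (X : topologicalType) (gX : topGroup X) x y :
  gmul gX x (gmul gX (ginv gX x) y) = y.
Proof. by rewrite gmulA gmulrV gmul1. Qed.

Lemma gmul_continuous (T X : topologicalType) (gX : topGroup X) (f g : T -> X) :
  continuous f -> continuous g -> continuous (fun t => gmul gX (f t) (g t)).
Proof.
move=> cf cg t; have cm := @gmul_cont _ gX.
exact: (continuous2_cvg _ (cm (f t, g t)) (cf t) (cg t)).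
Qed.

Lemma group_hom1 (X Y : topologicalType) (gX : topGroup X) (gY : topGroup Y) h :
  group_hom gX gY h -> h (gone gX) = gone gY.
Proof.
move=> hM; rewrite -[LHS](gmulK gY (h (gone gX))) -hM gmul1.
exact: gmulV.
Qed.

Lemma group_homV (X Y : topologicalType) (gX : topGroup X) (gY : topGroup Y) h x :
  group_hom gX gY h -> h (ginv gX x) = ginv gY (h x).
Proof.
move=> hM; rewrite -[LHS](gmulK gY (h x)) -hM gmulrV (group_hom1 hM).
exact: gmulr1.
Qed.

Lemma meager_preimage (T T' : topologicalType) (f : T -> T') (g : T' -> T)
    (M : set T') :
  cancel f g -> cancel g f -> continuous f -> continuous g ->
  meager M -> meager (f @^-1` M).
Proof.
move=> fK gK cf cg [N [ndN MN]]; exists (fun n => f @^-1` N n); split.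
  by move=> n; exact: nowhere_dense_preimage (ndN n).
by move=> x /MN[n _ Nx]; exists n.
Qed.

(** The case where the closed set is all of [X], carried back along the homeomorphism between [X]
    and its full subspace. *)
Lemma universally_BP_open (X Y : topologicalType) (h : X -> Y) (U : set Y) :
  universally_BP_measurable h -> open U ->
  exists O, [/\ open O, meager (O `\` h @^-1` U) & meager (h @^-1` U `\` O)].
Proof.
move=> hBP oU.
have [O [oO mO1 mO2]] := baire_property_open (hBP U setT oU closedT).
pose f (x : X) : set_type [set: X] := SigSub (mem_set (I : [set: X] x)).
have fK : cancel f set_val by [].
have gK : cancel set_val f by move=> x; apply: val_inj.
have cg : continuous (set_val : set_type [set: X] -> X).
  exact: initial_continuous.
have cf : continuous f.
  by apply/continuousP => _ [A oA <-].
exists (f @^-1` O); split.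
- by apply: open_comp => // ? _; exact: cf.
- exact: meager_preimage fK gK cf cg mO1.
- exact: meager_preimage fK gK cf cg mO2.
Qed.

(** For [g] near the identity, [O] meets its right translate by the inverse of [g] in a nonempty
    open set. If no [x] worked, this set would be covered by the meager [O \ A] and a translate of
    it, against Baire category. *)
Lemma pettis (X K : topologicalType) (e : X -> K) G (gX : topGroup X) (A O : set X) :
  cech_chart e G -> open O -> O !=set0 -> meager (O `\` A) ->
  nbhs (gone gX) [set g | exists x, A x /\ A (gmul gX x g)].
Proof.
move=> ch oO [a Oa] mOA.
have cid : continuous (@id X) by move=> x; exact: cvg_id.
have cl x : continuous (gmul gX x) by apply: gmul_continuous => //; exact: cst_continuous.
have cr x : continuous (fun y => gmul gX y x).
  by apply: gmul_continuous => //; exact: cst_continuous.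
have : nbhs (gone gX) (gmul gX a @^-1` O).
  by apply: (cl a); apply: open_nbhs_nbhs; rewrite gmulr1.
apply: filterS => g /= Oag; apply: contrapT => nA.
pose Q := O `&` [set x | O (gmul gX x g)].
have oQ : open Q by apply: openI => //; apply: open_comp => // x _; exact: cr.
apply: (chart_baire ch oQ); first by exists a.
have mg : meager ((fun x => gmul gX x g) @^-1` (O `\` A)).
  apply: (@meager_preimage _ _ _ (fun x => gmul gX x (ginv gX g))) => //.
  - by move=> x; rewrite -gmulA gmulrV gmulr1.
  - by move=> x; rewrite -gmulA gmulV gmulr1.
apply: meagerS _ (meagerU mOA mg) => x [Ox Oxg].
have [Ax|nAx] := pselect (A x); last by left.
by right; split=> // Axg; apply: nA; exists x.
Qed.

(** * Mycielski's construction *)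

(** The bound [k < size s] leaves finitely many conditions per level. Each is met by shrinking two
    open sets, since the quotient map is continuous and a quotient outside the closure of [N k] is
    available. *)
Lemma cantor_scheme (X K : topologicalType) (e : X -> K) G (gX : topGroup X)
    (N : nat -> set X) :
  cech_chart e G -> (forall n, nowhere_dense (N n)) ->
  exists O : seq bool -> set K, [/\ forall s, open (O s),
    forall s, exists x, O s (e x),
    forall s b, closure (O (rcons s b)) `<=` O s `&` G (size s) &
    forall s t k x y, size s = size t -> s <> t -> k < size s ->
      closure (O s) (e x) -> closure (O t) (e y) -> ~ N k (gmul gX (ginv gX x) y)].
Proof.
move=> ch ndN.
pose P (O : seq bool -> set K) := forall s, open (O s) /\ exists x, O s (e x).
have cid : continuous (@id X) by move=> x; exact: cvg_id.
pose avoids k (A B : set K) :=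
  forall x y, A (e x) -> B (e y) -> ~ N k (gmul gX (ginv gX x) y).
have avoid_pair k (A B : set K) : open A -> open B ->
    (exists x, A (e x)) -> (exists x, B (e x)) ->
    exists A' B', [/\ open A' /\ open B', exists x, A' (e x), exists x, B' (e x),
      A' `<=` A /\ B' `<=` B & avoids k A' B'].
  move=> oA oB [a Aa] [b Bb].
  (* With [a] fixed, [z] is the quotient to be found; the second point will be [gmul gX a z]. *)
  have oV : open [set z | B (e (gmul gX a z))].
    apply: (@open_comp _ _ (fun z => e (gmul gX a z))) => // z _.
    apply: continuous_comp; last exact: chart_cont ch _.
    by apply: gmul_continuous => //; exact: cst_continuous.
  have [|z [Bz nNz]] := nowhere_dense_avoid (ndN k) oV.
    by exists (gmul gX (ginv gX a) b); rewrite /= gmulVK.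
  have cdiv : continuous (fun p : X * X => gmul gX (ginv gX p.1) p.2).
    apply: gmul_continuous; last by move=> p; exact: cvg_snd.
    by move=> p; apply: continuous_comp; [exact: cvg_fst|exact: ginv_cont].
  have : nbhs (a, gmul gX a z)
      ((fun p : X * X => gmul gX (ginv gX p.1) p.2) @^-1` (~` closure (N k))).
    apply: (cdiv (a, gmul gX a z)); apply: open_nbhs_nbhs; split.
      exact/closed_openC/closed_closure.
    by rewrite /= gmulK.
  move=> [[/= V1 V2] [/= nV1 nV2] V12].
  have [A' oA' eA'] := chart_initial ch (@open_interior _ V1).
  have [B' oB' eB'] := chart_initial ch (@open_interior _ V2).
  exists (A `&` A'), (B `&` B'); split.
  - by split; exact: openI.
  - by exists a; split=> //; change ((e @^-1` A') a); rewrite eA'.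
  - by exists (gmul gX a z); split=> //; change ((e @^-1` B') (gmul gX a z)); rewrite eB'.
  - by split=> x [].
  - move=> x y [_ A'x] [_ B'y] Nxy.
    have V1x : V1 x by apply: interior_subset; rewrite -eA'.
    have V2y : V2 y by apply: interior_subset; rewrite -eB'.
    by have := V12 (x, y) (conj V1x V2y); apply; exact: subset_closure.
have avoid_list (l : seq (seq bool * seq bool * nat)) O : P O ->
    exists O', [/\ P O', forall s, O' s `<=` O s &
      forall s t k, (s, t, k) \in l -> s <> t -> avoids k (O' s) (O' t)].
  elim: l => [|[[s t] k] l IH] PO.
    by exists O; split=> // s; exact: subset_refl.
  have [O1 [PO1 O1O avO1]] := IH PO.
  have [A [B [[oA oB] A0 B0 [AO1 BO1] avAB]]] :=
    avoid_pair k _ _ (PO1 s).1 (PO1 t).1 (PO1 s).2 (PO1 t).2.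
  (* Only two sets shrink, so conditions already met persist; for [s = t] there is no condition to
     meet. *)
  pose O2 u := if u == s then A else if u == t then B else O1 u.
  have O2O1 u : O2 u `<=` O1 u.
    by rewrite /O2; case: eqP => [->//|_]; case: eqP => [->//|_].
  exists O2; split.
  - by move=> u; rewrite /O2; case: eqP => // _; case: eqP.
  - by move=> u; exact: subset_trans (O2O1 u) (O1O u).
  - move=> s' t' k'; rewrite inE => /orP[/eqP[-> -> ->] st|l' st' x y xO yO].
      by rewrite /O2 eqxx; case: eqP => [ts|_]; [case: st|rewrite eqxx].
    exact: (avO1 _ _ _ l' st' x y (O2O1 _ _ xO) (O2O1 _ _ yO)).
pose R n (O O' : seq bool -> set K) :=
  (forall s b, closure (O' (rcons s b)) `<=` O s `&` G n) /\
  forall s t k, size s = n.+1 -> size t = n.+1 -> s <> t -> k <= n ->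
    avoids k (closure (O' s)) (closure (O' t)).
have [||f [_ fP fR]] := @dep_choice _ (fun=> P) R (fun=> setT).
- by move=> s; split; [exact: openT|exists (gone gX)].
- move=> n O PO.
  (* All ordered pairs of words of length [n.+1], with all [k] up to [n]. *)
  pose L := [seq (tval p.1.1, tval p.1.2, nat_of_ord p.2) |
    p : n.+1.-tuple bool * n.+1.-tuple bool * 'I_n.+1].
  (* Each word starts from the set of its parent, obtained by dropping the last letter. *)
  have [|O1 [PO1 O1O avO1]] := avoid_list L (fun s => O (take (size s).-1 s)).
    by move=> s; exact: PO.
  have /choice[O' O'P] : forall s, exists V, [/\ open V, exists x, V (e x) &
      closure V `<=` O1 s `&` G n].
    move=> s; have [oO [x Ox]] := PO1 s.
    by have [V [oV Vx VO]] := chart_shrink n ch oO Ox; exists V; split=> //; exists x.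
  exists O'; first by move=> s; have [] := O'P s.
  split=> [s b x|s t k sn tn st kn].
    have [_ _ O'O] := O'P (rcons s b) => /O'O[/O1O].
    by rewrite size_rcons /= -cats1 take_size_cat.
  move=> x y; have [_ _ O's] := O'P s => /O's[xs _].
  have [_ _ O't] := O'P t => /O't[yt _].
  apply: (avO1 _ _ _ _ st _ _ xs yt); apply/mapP.
  have kn' : k < n.+1 by [].
  move/eqP: sn => sn; move/eqP: tn => tn.
  by exists (Tuple sn, Tuple tn, Ordinal kn') => //; rewrite mem_enum.
(* Stage [n] assigns a set to every word but is used only for words of length [n]. *)
exists (fun s => f (size s) s); split.
- by move=> s; have [] := fP (size s) s.
- by move=> s; have [] := fP (size s) s.
- by move=> s b; rewrite size_rcons; exact: (fR (size s)).1.
- move=> s t k x y st nst; rewrite -st => ks.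
  case sn: (size s) ks => [//|n] kn.
  exact: ((fR n).2 s t k sn (etrans (esym st) sn) nst kn x y).
Qed.

(** * Preimages of neighbourhoods are nonmeager, and continuity *)

Lemma hom_preimage_not_meager (X Y K : topologicalType) (e : X -> K) G
    (gX : topGroup X) (gY : topGroup Y) (h : X -> Y) (U : set Y) :
  cech_chart e G -> group_hom gX gY h -> universally_BP_measurable h ->
  open U -> U (gone gY) -> ~ meager (h @^-1` U).
Proof.
move=> ch hM hBP oU U1 [N0 [ndN0 UN0]].
have h1 := group_hom1 hM.
have [k0 _ N01] : (\bigcup_n N0 n) (gone gX) by apply: UN0; rewrite /= h1.
(* A set containing the identity goes first: avoiding [N 0] forbids [x = y], which makes cells of
   distinct words of equal length disjoint in [X]. *)
pose N n := if n is m.+1 then N0 m else N0 k0.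
have ndN (n : nat) : nowhere_dense (N n) by case: n => [|n]; exact: ndN0.
have UN : h @^-1` U `<=` \bigcup_n N n by move=> x /UN0[n _ Nx]; exists n.+1.
have [O [oO O0 OS Oav]] := cantor_scheme gX ch ndN.
pose C s := closure (O s).
have CS s b : C (rcons s b) `<=` C s.
  by move=> x /OS[Ox _]; exact: subset_closure.
have Cdisj s t x : size s = size t -> C s (e x) -> C t (e x) -> s = t.
  move=> st Csx Ctx; apply: contrapT => nst.
  have s0 : 0 < size s.
    rewrite lt0n; apply/eqP => s0; apply: nst.
    by move: st; rewrite s0 (size0nil s0) => /esym/size0nil.
  by apply: (Oav s t 0 x x st nst s0 Csx Ctx); rewrite gmulV.
have [F0 [clF0 CF0 F0base]] :
    exists F0, [/\ closed F0, forall s, (C s `&` F0) !=set0 &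
      forall V, open V -> (V `&` F0) !=set0 -> exists s, C s `&` F0 `<=` V].
  apply: minimal_closed_transversal (chart_compact ch) _ _.
  - by move=> s; exact: closed_closure.
  - by move=> s; have [x Ox] := O0 s; exists (e x); exact: subset_closure.
pose F := e @^-1` F0.
have clF : closed F.
  by apply: (closed_comp (f := e)) => // x _; exact: chart_cont ch _.
pose D s : set (set_type F) := [set x | C s (e (set_val x))].
have branch0 q : branch D q !=set0.
  have [|||x xq] := @chart_nested _ _ e G (fun n => C (mkseq q n) `&` F0) ch.
  - by move=> n; apply: closedI => //; exact: closed_closure.
  - by move=> n; exact: CF0.
  - move=> n y; rewrite mkseqS => -[/[dup] /CS Cy /OS[_ Gy] F0y].
    by rewrite size_mkseq in Gy; split.
  have Fx : x \in F by apply/mem_set; exact: (xq 0).2.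
  by exists (SigSub Fx) => n _; exact: (xq n).1.
have D0 s : D s !=set0.
  (* The branch is [s] continued by [false] forever. *)
  have [x xq] := branch0 (nth false s); exists x.
  by rewrite -(mkseq_nth false s); exact: xq.
have valc : continuous (set_val : set_type F -> X) by exact: initial_continuous.
have [S HS] := no_baire_selector.
(* The union of the translates of [U] by [h z], for [z] on branches in [S]. If [h x] is in it, then
   some such [z] has its quotient with [x] in the preimage of [U], hence in some [N k]. *)
pose V := \bigcup_(z in [set z | exists2 q, S q & forall n, C (mkseq q n) (e z)])
  [set y | U (gmul gY (ginv gY (h z)) y)].
have oV : open V.
  apply: bigcup_open => z _; apply: open_comp => // y _.
  apply: gmul_continuous => ?; [exact: cvg_cst|exact: cvg_id].
apply: (HS _ D [set x | V (h (set_val x))]).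
- by move=> s b x; exact: CS.
- by move=> s t st [x [Dsx Dtx]]; exact: Cdisj st Dsx Dtx.
- move=> _ [B oB <-] [x Bx].
  have [B' oB' eB] := chart_initial ch oB.
  have [|s sB] := F0base B' oB'.
    exists (e (set_val x)); split; last exact: (set_valP x).
    by move: Bx; rewrite /= -eB.
  exists s => y Dsy; rewrite /= -eB; apply: sB; split=> //.
  exact: (set_valP y).
(* The open set under the closed cell [D s] is nonempty since it contains the cells of the next
   level. *)
- move=> s; exists [set x | O s (e (set_val x))]; split.
  + apply: (@open_comp _ _ (fun x : set_type F => e (set_val x))) => // x _.
    by apply: continuous_comp; [exact: valc|exact: chart_cont ch _].
  + by have [x Dx] := D0 (rcons s true); exists x; exact: (OS _ _ _ Dx).1.
  + by move=> x Ox; exact: subset_closure.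
- exact: branch0.
- exact: hBP.
- move=> q Sq x xq; exists (set_val x); last by rewrite /= gmulV.
  by exists q => // n; exact: xq.
- move=> q nSq; apply/seteqP; split=> // x [xq [z [q' Sq' zq'] /=]].
  rewrite -(group_homV _ hM) -hM => /UN[k _ Nk].
  have [i qi] : exists i, q' i <> q i.
    apply: contrapT => nq; apply: nSq; suff <- : q' = q by [].
    by apply/funext => i; apply: contrapT => qi; apply: nq; exists i.
  (* Long enough for the prefixes to differ at [i] and for level [n] to handle [N k]. *)
  pose n := (maxn i k).+1.
  apply: (Oav (mkseq q' n) (mkseq q n) k _ _ _ _ _ (zq' n) (xq n I) Nk).
  + by rewrite !size_mkseq.
  + move=> /(congr1 (fun s => nth false s i)).
    by rewrite !nth_mkseq // ltnS leq_maxl.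
  + by rewrite size_mkseq ltnS leq_maxr.
Qed.

Theorem theorem1p4 (X Y : topologicalType) (gX : topGroup X) (gY : topGroup Y)
  (h : X -> Y) :
  cech_complete X -> group_hom gX gY h -> universally_BP_measurable h ->
  continuous h.
Proof.
move=> /cech_complete_chart[K [e [G ch]]] hM hBP.
have h1 := group_hom1 hM.
(* Continuity at the identity comes first; translations carry it to every point. *)
have at1 V : nbhs (gone gY) V -> nbhs (gone gX) (h @^-1` V).
  move=> nV.
  have cdiv : continuous (fun p : Y * Y => gmul gY (ginv gY p.1) p.2).
    apply: gmul_continuous; last by move=> p; exact: cvg_snd.
    by move=> p; apply: continuous_comp; [exact: cvg_fst|exact: ginv_cont].
  have : nbhs (gone gY, gone gY)
      ((fun p : Y * Y => gmul gY (ginv gY p.1) p.2) @^-1` V).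
    by apply: (cdiv (gone gY, gone gY)); rewrite /= gmulV.
  move=> [[/= V1 V2] [/= nV1 nV2] V12].
  (* Quotients of two elements of [U] lie in [V]; in the Pettis case [g] is the quotient of [x] and
     [gmul gX x g], both in the preimage of [U]. *)
  pose U := interior V1 `&` interior V2.
  have oU : open U by apply: openI; exact: open_interior.
  have [O [oO mO1 mO2]] := universally_BP_open hBP oU.
  have [O0|O0] := pselect (O !=set0).
    apply: filterS (pettis gX ch oO O0 mO1) => g [x [[Ux _] [_ Uxg]]].
    have := V12 (h x, h (gmul gX x g)).
    rewrite /= hM gmulK; apply; split; first exact: interior_subset.
    by rewrite /= -hM; exact: interior_subset.
  (* An empty [O] would make the whole preimage of [U] meager. *)
  have [] := hom_preimage_not_meager ch hM hBP oU.
    by split.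
  apply: meagerS _ mO2 => x Ux; split=> // Ox; apply: O0; by exists x.
move=> x V Vx.
have cl (Z : topologicalType) (gZ : topGroup Z) z : continuous (gmul gZ z).
  by apply: gmul_continuous => ?; [exact: cvg_cst|exact: cvg_id].
have : nbhs (gone gX) (h @^-1` (gmul gY (h x) @^-1` V)).
  by apply: at1; apply: cl; rewrite gmulr1.
move=> nW; have : nbhs x (gmul gX (ginv gX x) @^-1`
    (h @^-1` (gmul gY (h x) @^-1` V))) by apply: cl; rewrite gmulV.
by apply: filterS => y /=; rewrite -hM gmulVK.
Qed.
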